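(* Let $X$ be a Tychonoff space. The following are equivalent: (1) $C_{\Gamma}(X)$ is second countable; (2) $C_{\Gamma}(X)$ has a countable network; (3) $C_{\Gamma}(X)$ is separable; (4) $C_{\Gamma}(X)$ has ccc (the countable chain condition); (5) $X$ is compact and metrizable.
   Context: $C(X)$ is the set of all continuous functions $f:X\to\mathbb R$. The graph topology $\tau_{\Gamma}$ on $C(X)$ is the topology generated by the sets $F_U=\{f\in C(X): \text{graph}(f)\subseteq U\}$, where $U$ ranges over all nonempty open subsets of $X\times\mathbb R$; $C_{\Gamma}(X)$ denotes $(C(X),\tau_{\Gamma})$. A network of a space $Z$ is a family $\mathcal N$ of (not necessarily open) subsets of $Z$ such that every open set is a union of members of $\mathcal N$. A space has ccc if every family of pairwise disjoint nonempty open sets is countable. *)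

(* Defs.v *)
From HB Require Import structures.
From mathcomp Require Import all_boot all_order all_algebra.
From mathcomp Require Import all_classical all_reals all_analysis.
Set Implicit Arguments.
Unset Strict Implicit.
Unset Printing Implicit Defensive.
Import Order.TTheory GRing.Theory Num.Theory.
Import numFieldNormedType.Exports.
Local Open Scope classical_set_scope.
Local Open Scope ring_scope.

(* [completely_regular_space] is phrased with uniform separators; by the
   library's [uniform_separatorP], these are exactly the separations by a
   continuous function into [0, 1].  [accessible_space] is the T1 axiom. *)
Definition tychonoff_space (X : topologicalType) : Prop :=
  accessible_space X /\ completely_regular_space X.

Definition metrizable (R : realType) (X : topologicalType) : Prop :=
  exists m : Metric R X, @open (Metric.Pack m) = @open X.

Definition network (Z : topologicalType) (N : set (set Z)) : Prop :=
  forall U : set Z, open U ->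
    exists2 F : set (set Z), F `<=` N & U = \bigcup_(A in F) A.

Definition has_countable_network (Z : topologicalType) : Prop :=
  exists2 N : set (set Z), countable N & network N.

Definition separable (Z : topologicalType) : Prop :=
  exists2 S : set Z, countable S & dense S.

Definition ccc (Z : topologicalType) : Prop :=
  forall F : set (set Z),
    (forall A, F A -> open A /\ A !=set0) -> trivIset F id -> countable F.

Definition graph_of (S T : Type) (f : S -> T) : set (S * T) :=
  [set p | p.2 = f p.1].

(* An alias, so that the graph topology does not clash with the pointwise,
   uniform and compact-open topologies that the library's [ArrowAs...] modules
   put on [continuousType]. *)
Definition C_Gamma (R : realType) (X : topologicalType) : Type :=
  continuousType X R.

Section graph_topology.
Context {R : realType} {X : topologicalType}.

Definition graph_nbhd (U : set (X * R)) : set (C_Gamma R X) :=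
  [set f : continuousType X R | graph_of f `<=` U].

HB.instance Definition _ := Choice.on (C_Gamma R X).
HB.instance Definition _ := isSubBaseTopological.Build (C_Gamma R X)
  [set U : set (X * R) | open U /\ U !=set0] graph_nbhd.

End graph_topology.

(* Main.v *)
(* The implications from (1) to (4) hold in every space.

   (4) => (5).  The tubes of radius e/2 around the members of a maximal
   e-separated subset of C(X) are disjoint open sets, so ccc yields a countable
   uniform e-net.  As X is completely regular, the net separates points from
   closed sets, and this makes X metrizable with a countable base.  If X were
   not compact, it would contain a closed discrete sequence e_n, and the open
   sets {g | g(e_n) < 1/2 for n in S, g(e_n) > 1/2 for n not in S}, where S is
   any set of naturals, would form an uncountable disjoint family; Urysohn's
   lemma shows that they are nonempty.

   (5) => (1).  The graph of a continuous function on a compact space is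
   compact, so the sets F_W, for W a finite union of basic boxes of X x R, form
   a countable base. *)
Require Import Defs.
From HB Require Import structures.
From mathcomp Require Import all_boot all_order all_algebra.
From mathcomp Require Import all_classical all_reals all_analysis.
From mathcomp Require Import finmap lra.
Import Order.TTheory GRing.Theory Num.Theory.
Import numFieldNormedType.Exports.
Local Open Scope classical_set_scope.
Local Open Scope ring_scope.

Set Implicit Arguments.
Unset Strict Implicit.
Unset Printing Implicit Defensive.

(** * Countable bases *)

Definition base_family (I : Type) (X : topologicalType) (V : I -> set X) :=
  (forall i, open (V i)) /\
  forall x U, open U -> U x -> exists2 i, V i x & V i `<=` U.

Lemma base_family_second_countable (I : countType) (X : topologicalType)
    (V : I -> set X) : base_family V -> @second_countable X.
Proof.
move=> [oV bV]; exists (range V).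
  exact: card_le_trans (card_image_le _ _) (countableP _).
split=> [_ [i _ <-]//|x A]; rewrite nbhsE => -[U [oU Ux] UA].
by have [i Vix ViU] := bV _ _ oU Ux; exists (V i);
  [split => //; exists i|exact: subset_trans UA].
Qed.

Lemma second_countable_base_family (X : topologicalType) :
  @second_countable X -> exists V : nat -> set X, base_family V.
Proof.
move=> [B /countable_injP[h hinj] [oB bB]].
(* Injectivity of [h] leaves at most one member in each union, and none when [n] codes no set of
   [B]. *)
exists (fun n => \bigcup_(A in B `&` [set A | h A = n]) A); split.
  by move=> n; apply: bigcup_open => A [/oB].
move=> x U oU Ux; have [|A [BA Ax] AU] := bB x U; first exact: open_nbhs_nbhs.
exists (h A); first by exists A.
move=> y [C [BC hCA] Cy]; apply: AU.
by rewrite -(hinj _ _ (mem_set BC) (mem_set BA) hCA).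
Qed.

(** * From second countability down to ccc, in any space *)

Lemma second_countable_network (Z : topologicalType) :
  @second_countable Z -> has_countable_network Z.
Proof.
move=> [B cB [oB bB]]; exists B => // U oU.
exists [set A | B A /\ A `<=` U]; first by move=> A [].
apply/seteqP; split=> [x Ux|x [A [_ +] Ax]]; last exact.
have [|A [BA Ax] AU] := bB x U; first exact: open_nbhs_nbhs.
by exists A.
Qed.

Lemma countable_network_separable (Z : topologicalType) :
  has_countable_network Z -> separable Z.
Proof.
move=> [N cN netN]; have [[z0 _]|Z0] := pselect (exists z : Z, True); last first.
  by exists set0 => // O [z _]; case: Z0; exists z.
(* [xget z0] picks a point in every nonempty member of the network; [z0] serves for an empty one. *)
exists (xget z0 @` N); first exact: card_le_trans (card_image_le _ _) cN.
move=> O [z Oz] /netN[F FN OF]; move: Oz; rewrite OF => -[A FA Az].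
exists (xget z0 A); split; last by exists A => //; exact: FN.
by exists A => //; exact: xgetI Az.
Qed.

Lemma separable_ccc (Z : topologicalType) : separable Z -> ccc Z.
Proof.
move=> [S /countable_injP[h hinj] dS] F oF tF.
have [->//|/set0P[A0 FA0]] := eqVneq F set0.
have [_ [z0 _]] := oF _ FA0.
have pick A : F A -> (A `&` S) (xget z0 (A `&` S)).
  by move=> FA; have [oA An0] := oF _ FA; have [z Az] := dS _ An0 oA;
    exact: xgetI Az.
apply/countable_injP; exists (fun A => h (xget z0 (A `&` S))).
move=> A B /set_mem FA /set_mem FB.
have [Az Sz] := pick _ FA; have [Bw Sw] := pick _ FB.
move=> /(hinj _ _ (mem_set Sz) (mem_set Sw)) zw.
by apply: (tF A B FA FB); exists (xget z0 (A `&` S)); split=> //; rewrite zw.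
Qed.

(** * Compactness, metrizability and normality *)

Lemma compact_cover_compact (X : topologicalType) :
  compact [set: X] -> cover_compact [set: X].
Proof.
have [[x0 _] cX|X0 _ I D f _ _] := pselect (exists x : X, True); last first.
  by exists fset0 => // x; case: X0; exists x.
pose T : ptopologicalType :=
  HB.pack (X : Type) (Topological.class X) (isPointed.Build X x0).
have : @compact T [set: T] := cX; by rewrite compact_cover.
Qed.

Lemma metric_compact_second_countable (R : realType) (M : metricType R) :
  compact [set: M] -> @second_countable M.
Proof.
have [[x0 _] cM|X0 _] := pselect (exists x : M, True); last first.
  exists set0 => //; split=> // x; case: X0; by exists x.
pose T : pseudoPMetricType R :=
  HB.pack (M : Type) (Metric.class M) (isPointed.Build M x0).
exact: (@compact_second_countable R T).
Qed.

Lemma open_setX (X Y : topologicalType) (A : set X) (B : set Y) :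
  open A -> open B -> open (A `*` B).
Proof.
move=> oA oB; have -> : A `*` B = (fst @^-1` A) `&` (snd @^-1` B) by [].
by apply: openI; apply: open_comp => // p _; [exact: cvg_fst|exact: cvg_snd].
Qed.

Lemma metrizable_compact_second_countable (R : realType) (X : topologicalType) :
  metrizable R X -> compact [set: X] -> @second_countable X.
Proof.
move=> [m mX] cX; pose M := Metric.Pack m.
(* [metrizable] identifies only the open sets, whereas clustering and bases are phrased with
   neighbourhoods. *)
have nbhsMX : @nbhs M M = @nbhs X X.
  apply/funext => x; apply/funext => A; apply/propext; rewrite !nbhsE /open_nbhs.
  by rewrite [@open M]mX.
have : @second_countable M.
  apply: metric_compact_second_countable => F PF FT.
  have [x [_ clx]] := cX F PF FT; exists x; split=> // A B FA.
  by rewrite nbhsMX; exact: clx.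
move=> [B cB [oB bB]]; exists B => //; split.
  by move=> A /oB; rewrite [@open M]mX.
by move=> x; rewrite -nbhsMX; exact: bB.
Qed.

Lemma metrizable_normal (R : realType) (X : topologicalType) :
  metrizable R X -> normal_space X.
Proof.
move=> [m mX]; pose M := Metric.Pack m.
(* With closedness read off complements, this form of normality mentions open sets only and so
   passes along [mX]. *)
apply/(@normal_openP R) => A B; rewrite -!openC -mX => cA cB AB.
have := (@normal_openP R M).1 (@pseudometric_normal R M) A B.
rewrite -!(@openC M) => /(_ cA cB AB); rewrite [@open M]mX.
exact.
Qed.

(** * Neighbourhoods in the graph topology *)

Lemma open_graph_nbhd (R : realType) (X : topologicalType) (U : set (X * R)) :
  open U -> open (graph_nbhd U).
Proof.
(* The subbase is indexed by nonempty [U]. For empty [U] the set is empty if [X] has a point, and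
   the whole space otherwise. *)
move=> oU; have [U0|/set0P Un0] := eqVneq U set0; last first.
  exists [set graph_nbhd U]; last by rewrite bigcup_set1.
  move=> _ ->; exists [fset U]%fset; last by rewrite set_fset1 bigcap_set1.
  by move=> V; rewrite inE => /eqP ->; apply: mem_set; split=> //; apply/set0P.
have [[x _]|X0] := pselect (exists x : X, True).
  suff -> : graph_nbhd U = set0 by exact: open0.
  rewrite -subset0 => f /(_ (x, f x) erefl); by rewrite U0.
suff -> : graph_nbhd U = setT by exact: openT.
by rewrite -subTset => f _ [x y] _; case: X0; exists x.
Qed.

(** Finite intersections of sets [graph_nbhd U] are again of this form, so the subbase behaves as a
    base. *)
Lemma graph_nbhd_base (R : realType) (X : topologicalType)
    (O : set (C_Gamma R X)) (f : C_Gamma R X) : open O -> O f ->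
  exists U, [/\ open U, graph_nbhd U f & graph_nbhd U `<=` O].
Proof.
move=> [D sD <-] [A DA fA]; have [B sB AB] := sD _ DA; rewrite -AB in DA fA.
exists (\bigcap_(U in [set` B]) U); split.
- rewrite bigcap_fset big_seq; elim/big_ind: _ => //; [exact: openT|exact: openI|].
  by move=> U /sB /set_mem[].
- by move=> p fp U BU; exact: fA BU _ fp.
- move=> g gB; exists (\bigcap_(U in [set` B]) graph_nbhd U) => //.
  by move=> U BU p gp; exact: gB p gp U BU.
Qed.

(** * From ccc to a countable uniform net *)

Lemma ccc_uniform_net (R : realType) (X : topologicalType) (e : R) :
  0 < e -> ccc (C_Gamma R X) ->
  exists f : nat -> X -> R, (forall n, continuous (f n)) /\
    forall g, continuous g -> exists n, forall x, `|f n x - g x| < e.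
Proof.
move=> e0 cccX.
pose val (f : C_Gamma R X) : X -> R := f : continuousType X R.
have cval f : continuous (val f) by move=> x; exact: cts_fun.
(* Sets in [P] are the [e]-separated ones; unions of chains stay in [P], so Zorn's lemma gives a
   maximal [D]. *)
pose P := [set D : set (C_Gamma R X) | forall f g, D f -> D g ->
  (forall x, `|val f x - val g x| < e) -> f = g].
have [|D [PD maxD]] := @Zorn_bigcup _ P.
  move=> F FP totF f g [A FA Af] [B FB Bg].
  have [AB|BA] := totF _ _ FA FB.
    by apply: (FP _ FB) => //; exact: AB.
  by apply: (FP _ FA) => //; exact: BA.
pose tube f := graph_nbhd [set p : X * R | `|p.2 - val f p.1| < e / 2].
have tubeP f g : tube f g <-> forall x, `|val g x - val f x| < e / 2.
  split=> [fg x|fg [x y]]; last by rewrite /graph_of /= => ->; exact: fg.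
  exact: (fg (x, val g x)).
have tubexx f : tube f f by apply/tubeP => x; rewrite subrr normr0 divr_gt0.
have tube_meet f g h : tube f h -> tube g h ->
    forall x, `|val f x - val g x| < e.
  move=> /tubeP fh /tubeP gh x; rewrite [e]splitr.
  by rewrite (le_lt_trans (ler_distD (val h x) _ _))// ltrD// distrC.
have otube f : open (tube f).
  apply: open_graph_nbhd.
  have -> : [set p : X * R | `|p.2 - val f p.1| < e / 2] =
    (fun p : X * R => `|p.2 - val f p.1|) @^-1` [set y | y < e / 2] by [].
  apply: open_comp; last exact: open_lt.
  move=> [x y] _; apply: cvg_norm; apply: cvgB; first exact: cvg_snd.
  by apply: continuous_comp; [exact: cvg_fst|exact: cval].
(* Members of [D] whose tubes meet are less than [e] apart everywhere, hence equal; so distinct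
   tubes are disjoint. *)
have /countable_injP[i iinj] : countable (tube @` D).
  apply: cccX => [_ [f _ <-]|_ _ [f Df <-] [g Dg <-] [h [fh gh]]].
    by split; [exact: otube|exists f].
  by congr tube; apply: PD => //; exact: tube_meet fh gh.
have D_dense g : exists2 f, D f & forall x, `|val f x - val g x| < e.
  apply: contrapT => Dg; apply: (maxD (D `|` [set g])).
    split; first exact: subsetUl.
    move=> DgD; apply: Dg; exists g; first by apply: DgD; right.
    by move=> x; rewrite subrr normr0.
  move=> f h [Df|->] [Dh|->] fh //; first exact: PD.
    by case: Dg; exists f.
  by case: Dg; exists h => // x; rewrite distrC.
pose f0 : C_Gamma R X := mkcts (@cst_continuous X R 0) : continuousType X R.
(* [F n] has at most one element; codes of no tube receive the zero function [f0]. *)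
pose F n := D `&` [set f | i (tube f) = n].
exists (fun n => val (xget f0 (F n))); split=> [n|g cg]; first exact: cval.
have [f Df fg] := D_dense (mkcts cg : continuousType X R).
exists (i (tube f)); have /(xgetPex f0)[] : exists h, F (i (tube f)) h.
  by exists f.
move: (xget _ _) => h Dh hf; suff -> : h = f by exact: fg.
have {}hf : tube h = tube f by apply: iinj hf; apply/mem_set; [exists h|exists f].
by apply: PD => //; apply: (@tube_meet _ _ f) => //; rewrite hf.
Qed.

(** Some continuous [g] is 0 at [x] and 1 off [U]. An [f n] within 1/3 of it is below 1/3 at [x] and
    above 2/3 off [U], so a change below 1/3 cannot leave [U]. *)
Lemma uniform_net_separates (R : realType) (X : topologicalType)
    (f : nat -> X -> R) :
  completely_regular_space X ->
  (forall g, continuous g -> exists n, forall x, `|f n x - g x| < 3^-1) ->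
  forall x U, open U -> U x ->
    exists n, forall y, `|f n x - f n y| < 3^-1 -> U y.
Proof.
move=> crX netf x U oU Ux.
have /(@uniform_separatorP _ R)[g [cg _ gx gU]] :
    uniform_separator [set x] (~` U).
  by apply: crX; [exact: open_closedC|apply].
have [n fg] := netf g cg; exists n => y fxy; apply: contrapT => nUy.
have {}gx : g x = 0 by apply: gx; exists x.
have {}gU : g y = 1 by apply: gU; exists y.
have := fg x; have := fg y; move: fxy; rewrite gx gU !ltr_norml; lra.
Qed.

(** * A base and a metric from a separating sequence *)

Section separating_sequence.
Context (R : realType) (X : topologicalType) (f : nat -> X -> R) (r : R).
Hypotheses (r0 : 0 < r) (cf : forall n, continuous (f n)).
Hypothesis sepf : forall x U, open U -> U x ->
  exists n, forall y, `|f n x - f n y| < r -> U y.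

Lemma separating_base_family : base_family (fun p : nat * (rat * rat) =>
  f p.1 @^-1` `]ratr p.2.1, ratr p.2.2[).
Proof.
split=> [[n [a b]]|x U oU Ux] /=.
  by apply: open_comp; [move=> ? _; exact: cf|exact: interval_open].
have [n nU] := sepf oU Ux.
have [|a] := @rat_in_itvoo R (f n x - r) (f n x); first by move: r0; lra.
have [|b] := @rat_in_itvoo R (f n x) (f n x + r); first by move: r0; lra.
rewrite !in_itv /= => /andP[xb bx] /andP[ax xa]; exists (n, (a, b)) => /=.
  by rewrite in_itv /= xa xb.
move=> y /=; rewrite in_itv /= => /andP[ay yb]; apply: nU.
by rewrite ltr_norml; apply/andP; split; lra.
Qed.

(** Truncating the n-th difference at 1/(n+1) bounds the supremum and leaves only finitely many
    terms to control at any given scale. *)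
Let term x y n := Num.min `|f n x - f n y| n.+1%:R^-1.
Let dist x y := sup (range (term x y)).

Let term_dist x y n : term x y n <= dist x y.
Proof.
apply: ub_le_sup; last by exists n.
by exists 1 => _ [m _ <-]; rewrite ge_min invf_le1 ?ler1n ?orbT.
Qed.

Let dist_le x y c : (forall n, term x y n <= c) -> dist x y <= c.
Proof.
by move=> tc; apply: ge_sup => [|_ [n _ <-]//]; exists (term x y 0), 0.
Qed.

(** A distance below 1/(n+1) means that the n-th term is not truncated, so it is the difference to
    which [sepf] applies. *)
Let dist_sep x U : open U -> U x ->
  exists2 e, 0 < e & [set y | dist x y < e] `<=` U.
Proof.
move=> oU Ux; have [n nU] := sepf oU Ux.
exists (Num.min r n.+1%:R^-1); first by rewrite lt_min r0 /=.
move=> y /=; rewrite lt_min => /andP[dr dn]; apply: nU.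
have := term_dist x y n; rewrite ge_min => /orP[tn|tn].
  exact: le_lt_trans tn dr.
by have := le_lt_trans tn dn; rewrite ltxx.
Qed.

Let distxx x : dist x x = 0.
Proof.
apply/eqP; rewrite eq_le; apply/andP; split.
  by apply: dist_le => n; rewrite /term subrr normr0 ge_min lexx.
by apply: le_trans (term_dist x x 0); rewrite /term subrr normr0 le_min lexx /=.
Qed.

Let dist_sym x y : dist x y = dist y x.
Proof.
by congr (sup (_ @` _)); apply/funext => n; rewrite /term distrC.
Qed.

Let dist_triangle y x z : dist x z <= dist x y + dist y z.
Proof.
apply: dist_le => n; apply: le_trans (lerD (term_dist x y n) (term_dist y z n)).
have := ler_distD (f n y) (f n x) (f n z); rewrite /term.
have : 0 < n.+1%:R^-1 :> R by [].
have := normr_ge0 (f n x - f n y); have := normr_ge0 (f n y - f n z).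
move: (`|_|) (`|_|) (`|_|) (_^-1) => a b c d.
by case: (lerP c d); case: (lerP b d); case: (lerP a d); lra.
Qed.

Lemma separating_metrizable : accessible_space X -> metrizable R X.
Proof.
move=> T1.
have dist_pos x y : dist x y = 0 -> x = y.
  apply: contraPP => /eqP /T1[U [oU [/set_mem Ux /set_mem nUy]]] dxy.
  have [e e0 eU] := dist_sep oU Ux.
  by apply: nUy; apply: eU; rewrite /= dxy.
pose M : metricType R := HB.pack (X : Type) (Choice.class X)
  (isMetric.Build R X distxx dist_pos dist_sym dist_triangle).
exists (Metric.class M); apply/funext => A; apply/propext.
split=> oA.
  change (open A) in oA; rewrite openE => x Ax.
  move: oA; rewrite openE => /(_ _ Ax).
  rewrite /interior -nbhs_ballE => -[e /= e0].
  rewrite ballEmdist => eA.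
  (* Near [x], the terms with index at most [N] are below [e / 2] by continuity; the later ones are
     at most 1/(N+1). Both bounds are strictly below [e], hence so is the supremum. *)
  have [N Ne] := ltr_add_invr e0; rewrite add0r in Ne.
  have : \forall y \near x, forall n : 'I_N.+1, `|f n x - f n y| < e / 2.
    apply: filter_forall => n; apply: cvgr_dist_lt; first exact: cf.
    by rewrite divr_gt0.
  apply: filterS => y xy; apply: eA => /=.
  apply: (@le_lt_trans _ _ (Num.max (e / 2) N.+1%:R^-1)).
    apply: dist_le => n; rewrite /term.
    have [nN|Nn] := ltnP n N.+1.
      by rewrite ge_min le_max (ltW (xy (Ordinal nN))).
    by rewrite ge_min !le_max lef_pV2 ?posrE // ler_nat ltnW ?orbT.
  by rewrite gt_max Ne andbT; move: e0; lra.
suff : open (A : set M) by [].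
rewrite openE => x Ax; rewrite /interior -nbhs_ballE.
have [e e0 eA] := dist_sep oA Ax.
by exists e => //; rewrite ballEmdist.
Qed.
End separating_sequence.

(** * Failure of ccc over a noncompact space *)

(** For an injective sequence in a T1 space, this amounts to a closed discrete range. *)
Definition locally_finite_seq (X : topologicalType) (e : nat -> X) :=
  forall x : X, exists2 U, nbhs x U &
    exists N, forall n, (N <= n)%N -> ~ U (e n).

(** Take a proper filter [F] without cluster point: each [x] lies in a basic set [V (k x)] with
    complement in [F]. Finitely many such complements have a common point, which supplies the terms
    of the sequence. *)
Lemma noncompact_locally_finite_seq (X : topologicalType) (V : nat -> set X) :
  base_family V -> ~ compact [set: X] ->
  exists2 e : nat -> X, injective e & locally_finite_seq e.
Proof.
move=> [oV bV] /existsNP[F /not_implyP[PF /not_implyP[_]]].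
move=> /set0P/negP/negPn/eqP clF.
have /choice[k kP] x : exists k, V k x /\ F (~` V k).
  have : ~ cluster F x by move=> Fx; suff : set0 x by []; rewrite -clF.
  move=> /existsNP[A /existsNP[B /not_implyP[FA /not_implyP[xB AB0]]]].
  move: xB; rewrite nbhsE => -[C [oC Cx] CB].
  have [k Vk VC] := bV _ _ oC Cx; exists k; split => //.
  by apply: filterS FA => y Ay Vy; apply: AB0; exists y; split=> //; apply/CB/VC.
have /choice[p pP] m : exists x, forall j, (j < m)%N -> F (~` V j) -> ~ V j x.
  suff : F [set x | forall j : 'I_m, F (~` V j) -> ~ V j x].
    by move=> /filter_ex[x xP]; exists x => j jm; exact: (xP (Ordinal jm)).
  apply: filter_forall => j; have [FV|nFV] := pselect (F (~` V j)).
    by apply: filterS FV => x Vx _.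
  by apply: filterE => x /nFV.
(* M n.+1 exceeds the index of the basic set chosen for the point p (M n), so
   all later points avoid that set: this gives injectivity. *)
pose M n := iter n (fun m => (k (p m)).+1) 0%N.
have ltM n : (M n < M n.+1)%N.
  rewrite /= ltnS leqNgt; apply/negP => kM.
  by have [Vk FV] := kP (p (M n)); exact: pP kM FV Vk.
have leM : {homo M : m n / (m <= n)%N}.
  by apply: homo_leq => //; [exact: leq_trans|move=> n; exact/ltnW].
have geM n : (n <= M n)%N by elim: n => // n /leq_ltn_trans; apply.
exists (p \o M).
  have ltNe i n : (i < n)%N -> p (M i) <> p (M n).
    move=> lin pE; have [Vk FV] := kP (p (M i)); rewrite {2}pE in Vk.
    have := pP (M n) _ _ FV Vk; apply.
    exact: (leM _ _ lin).
  move=> i n /= pE; have [/ltNe//|/ltNe/nesym//|//] := ltngtP i n.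
(* [V (k x)] contains no [p m] with [m > k x], and [M n >= n]. *)
move=> x; have [Vk FV] := kP x; exists (V (k x)); first exact: open_nbhs_nbhs.
exists (k x).+1 => n kn; apply: pP FV; exact: leq_trans kn (geM n).
Qed.

(** Near [x] only the finitely many terms with index below [N] can occur, and these form a closed
    set by T1. *)
Lemma locally_finite_seq_closed (X : topologicalType) (e : nat -> X)
    (S : set nat) :
  accessible_space X -> locally_finite_seq e -> closed (e @` S).
Proof.
move=> T1 fe x clx; have [U xU [N UN]] := fe x.
apply: contrapT => Sx; pose A := e @` (S `&` `I_N).
have clA : closed A.
  apply: (accessible_finite_set_closed.1 T1).
  exact: finite_image (finite_setIr _ (finite_II N)).
have : nbhs x (U `&` ~` A).
  apply: filterI => //; apply: open_nbhs_nbhs; split; first exact: closed_openC.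
  by move=> [n [Sn _] enx]; apply: Sx; exists n.
move=> /clx[_ [[n Sn <-] [Un An]]]; apply: (UN n) => //.
by rewrite leqNgt; apply/negP => nN; apply: An; exists n.
Qed.

Lemma locally_finite_seq_not_ccc (R : realType) (X : topologicalType)
    (e : nat -> X) :
  accessible_space X -> normal_space X -> injective e -> locally_finite_seq e ->
  ~ ccc (C_Gamma R X).
Proof.
move=> T1 nX einj fe cccX.
have cle S : closed (e @` S) by exact: locally_finite_seq_closed.
(* Heights are constrained only over the sequence: below 1/2 over terms indexed by [S], above 1/2
   over the others. As both sets of terms are closed, [G S] is open. *)
pose G S : set (X * R) :=
  (~` (e @` S) `*` setT `|` setT `*` [set y | y < 2^-1]) `&`
  (~` (e @` ~` S) `*` setT `|` setT `*` [set y | y > 2^-1]).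
have GP S (g : C_Gamma R X) : graph_nbhd (G S) g <->
    forall n, if n \in S then (g : continuousType X R) (e n) < 2^-1
      else (g : continuousType X R) (e n) > 2^-1.
  split=> [gS n|gS [x y]]; last first.
    rewrite /graph_of /= => ->; split.
      have [[n Sn <-]|] := pselect ((e @` S) x); last by left.
      by right; split => //; have := gS n; rewrite mem_set.
    have [[n Sn <-]|] := pselect ((e @` ~` S) x); last by left.
    by right; split => //; have := gS n; rewrite memNset.
  have /= := gS (e n, (g : continuousType X R) (e n)) erefl.
  move=> [g1 g2]; case: ifPn => [/set_mem Sn|/negP Sn].
    by case: g1 => -[]// + _; case; exists n.
  case: g2 => -[]// + _; case; exists n => // Sn'; apply: Sn; exact: mem_set.
have oG S : open (graph_nbhd (G S)).
  apply: open_graph_nbhd; apply: openI; apply: openU; apply: open_setX => //;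
  by [exact: closed_openC|exact: openT|exact: open_lt|exact: open_gt].
have G0 S : graph_nbhd (G S) !=set0.
  have : uniform_separator (e @` S) (e @` ~` S).
    apply: (normal_separatorP.1 nX) => //.
    by rewrite -subset0 => x [[n Sn <-] [m Sm /einj mn]]; apply: Sm; rewrite mn.
  move=> /(@uniform_separatorP _ R)[g [cg _ g0 g1]].
  exists (mkcts cg : continuousType X R); apply/GP => n.
  case: ifPn => [/set_mem Sn|/negP Sn].
    rewrite /= /mkcts (_ : g _ = 0) //; apply: g0; by exists (e n) => //; exists n.
  rewrite /= /mkcts (_ : g _ = 1); first by rewrite invf_lt1 // ltr1n.
  apply: g1; exists (e n) => //; exists n => // Sn'; apply: Sn; exact: mem_set.
(* A member [g] recovers the index: [S] consists of the [n] with [g (e n) < 1/2]. *)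
have Ginj S T g : graph_nbhd (G S) g -> graph_nbhd (G T) g -> S = T.
  move=> /GP gS /GP gT; apply/seteqP; split => n Sn; apply: contrapT => Tn.
    have := gS n; have := gT n; rewrite (mem_set Sn) (memNset Tn).
  move=> /lt_trans/[apply].
    by rewrite ltxx.
  have := gS n; have := gT n; rewrite (mem_set Sn) (memNset Tn).
  move=> /lt_trans/[apply].
  by rewrite ltxx.
have /countable_injP[i iinj] : countable (range (fun S => graph_nbhd (G S))).
  apply: cccX => [_ [S _ <-]|_ _ [S _ <-] [T _ <-] [g [gS gT]]]; first by split.
  by rewrite (Ginj S T g).
have {}iinj S T : i (graph_nbhd (G S)) = i (graph_nbhd (G T)) -> S = T.
  move=> /iinj GST; have [g gS] := G0 S; apply: (Ginj S T g) => //.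
  by rewrite -GST //; apply/mem_set; [exists S|exists T].
(* Cantor's diagonal set, for the injection of sets of naturals into naturals induced by [i]. *)
pose D := [set n | exists2 S, i (graph_nbhd (G S)) = n & ~ S n].
have [DD|nDD] := pselect (D (i (graph_nbhd (G D)))).
  by have [S /iinj SD] := DD; rewrite SD.
by apply: (nDD); exists D.
Qed.

(** * A countable base over a compact second countable space *)

Lemma compact_C_Gamma_second_countable (R : realType) (X : topologicalType) :
  compact [set: X] -> @second_countable X -> @second_countable (C_Gamma R X).
Proof.
move=> cX /second_countable_base_family[V [oV bV]].
pose box (p : nat * (rat * rat)) : set (X * R) :=
  V p.1 `*` `]ratr p.2.1, ratr p.2.2[.
have obox p : open (box p) by apply: open_setX => //; exact: interval_open.
pose W (s : seq (nat * (rat * rat))) := \bigcup_(p in [set` s]) box p.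
apply: (@base_family_second_countable _ _ (fun s => graph_nbhd (W s))); split.
  by move=> s; apply: open_graph_nbhd; apply: bigcup_open.
move=> f O oO Of; have [U [oU fU UO]] := graph_nbhd_base oO Of.
pose v : X -> R := f : continuousType X R.
have cv : continuous v by move=> x; exact: cts_fun.
have /choice[k kP] x : exists p, box p (x, v x) /\ box p `<=` U.
  have : nbhs (x, v x) U by apply: open_nbhs_nbhs; split=> //; exact: fU.
  move=> [[A B] /= [xA fB] ABU].
  move: xA; rewrite nbhsE => -[A' [oA' A'x] A'A].
  have [n Vx VA] := bV _ _ oA' A'x.
  move: fB; rewrite -nbhs_ballE => -[r /= r0 rB].
  have [|a] := @rat_in_itvoo R (v x - r) (v x); first by lra.
  have [|b] := @rat_in_itvoo R (v x) (v x + r); first by lra.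
  rewrite !in_itv /= => /andP[xb bx] /andP[ax xa]; exists (n, (a, b)); split.
    by split => //=; rewrite in_itv /= xa xb.
  move=> [y z] /= [/= Vy]; rewrite in_itv /= => /andP[az zb]; apply: ABU.
  split; first exact/A'A/VA.
  by apply: rB; rewrite /ball /= ltr_norml; apply/andP; split; lra.
(* The preimages of the boxes under [y => (y, v y)] cover [X]; a finite subcover gives boxes that
   cover the graph and stay inside [U]. *)
have [|x _|D _ cD] := @compact_cover_compact _ cX X setT
  (fun x => (fun y => (y, v y)) @^-1` box (k x)).
- move=> x _; apply: open_comp => // y _.
  exact: (@cvg_pair _ _ _ _ (nbhs y) (nbhs (v y)) _ _ _ id v cvg_id (cv y)).
- by exists x => //; exact: (kP x).1.
exists [seq k x | x <- D].
  move=> [x y]; rewrite /graph_of /= => ->; have [z zD zx] := cD x I.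
  by exists (k z) => //; exact: map_f.
move=> g gW; apply: UO => p /gW[q /mapP[x _ ->]]; exact: (kP x).2.
Qed.

Unset Implicit Arguments.

Theorem theorem5p2 (R : realType) (X : topologicalType)
    (hX : tychonoff_space X) :
  [<-> @second_countable (C_Gamma R X);
       has_countable_network (C_Gamma R X);
       separable (C_Gamma R X);
       ccc (C_Gamma R X);
       compact [set: X] /\ metrizable R X].
Proof.
have [T1 crX] := hX.
tfae.
- exact: second_countable_network.
- exact: countable_network_separable.
- exact: separable_ccc.
- move=> cccX; have e0 : 0 < 3^-1 :> R by [].
  have [f [cf netf]] := ccc_uniform_net e0 cccX.
  have sepf := uniform_net_separates crX netf.
  (* Metrizability comes before compactness: it supplies the normality that rules out a noncompact
     [X]. *)
  have metX := separating_metrizable e0 cf sepf T1.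
  split=> //; apply: contrapT => ncX.
  have [V bV] := second_countable_base_family
    (base_family_second_countable (separating_base_family e0 cf sepf)).
  have [e einj fe] := noncompact_locally_finite_seq bV ncX.
  exact: locally_finite_seq_not_ccc T1 (metrizable_normal metX) einj fe cccX.
- move=> [cX metX]; apply: compact_C_Gamma_second_countable => //.
  exact: metrizable_compact_second_countable metX cX.
Qed.
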